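(* Let $0<a<b$ and $0<s<1$. Then for all $q>1$, with $p$ defined by $\frac1p+\frac1q=1$, $$\left|L_s^s(a,b)-A^s(a,b)\right|\le \frac{(b-a)^2 s(1-s)}{16(s+1)^{1/q}(2p+1)^{1/p}}\left[\left(a^{(s-2)q}+A^{(s-2)q}(a,b)\right)^{1/q}+\left(A^{(s-2)q}(a,b)+b^{(s-2)q}\right)^{1/q}\right].$$
   Context: For nonnegative real numbers $\alpha,\beta$, $A(\alpha,\beta)=\frac{\alpha+\beta}{2}$ is the arithmetic mean, and $A^r(\alpha,\beta)=(A(\alpha,\beta))^r$. For $0<\alpha<\beta$ and a real exponent $n\ne -1,0$, $L_n(\alpha,\beta)=\left[\frac{\beta^{n+1}-\alpha^{n+1}}{(\beta-\alpha)(n+1)}\right]^{1/n}$ is the generalized logarithmic mean, and $L_n^n(\alpha,\beta)=(L_n(\alpha,\beta))^n=\frac{\beta^{n+1}-\alpha^{n+1}}{(\beta-\alpha)(n+1)}$. *)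

(* Defs.v *)
From Stdlib Require Import Reals.
Open Scope R_scope.

Definition arith_mean (alpha beta : R) : R := (alpha + beta) / 2.

(* Meaningful for [0 < alpha < beta] and [n <> -1, 0]; there the bracket is
   positive, so [Rpower], which is a true power only at a positive base, is the
   usual real power in all three places. *)
Definition gen_log_mean (n alpha beta : R) : R :=
  Rpower
    ((Rpower beta (n + 1) - Rpower alpha (n + 1)) / ((beta - alpha) * (n + 1)))
    (1 / n).

(* Main.v *)
Require Import Defs.
From Stdlib Require Import Reals.
From Stdlib Require Import Lra.
From Coquelicot Require Import Coquelicot.
Open Scope R_scope.

(** Let [m = (a+b)/2] and [F x = x^(s+1)/(s+1)], so that
    [L_s^s(a,b) = (F b - F a)/(b - a)], [A^s(a,b) = F' m] and
    [F''' x = - s(1-s) x^(s-2)].  Expand [F] to second order at [m] towards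
    each endpoint and divide by the step: when the two quotients are averaged,
    the second-order terms cancel, and [L_s^s - A^s] is the average of the two
    Taylor remainders so divided.  They are nonpositive since [F''' <= 0].
    Since [x^(s-2)] is convex, [F'''] is bounded below by its linear
    interpolation between [m] and the endpoint; integrating that three times
    gives the bound
    [(b-a)^2 s(1-s)/16 * ((X/4 + Y/12) + (X/4 + Z/12))] with
    [X = m^(s-2)], [Y = a^(s-2)], [Z = b^(s-2)]
    (lemmas [power_remainder_bounds] and [mean_gap_bound]).

    It remains to compare [X/4 + Y/12] with the [q]-norm of [(X, Y)], and
    likewise for [Z] ([weighted_sum_bound]).  The two-term Hoelder inequality
    reduces this to [(1/4)^p + (1/12)^p <= 2^(1-p)/(2p+1)], an equality at
    [p = 1].  That inequality, [weights_bound], follows from the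
    Bernoulli-type bound [1 + (2/3) x <= k^x] for [k >= 2] and [x >= 0], that
    is, from [ln 2 >= 2/3].  This yields the constant [2^(-1/q)], and
    [s + 1 <= 2] finishes the proof. *)

(** * Convexity of the exponential and its consequences *)

(** Jensen's inequality for two points: the tangent line of [exp] at the
    weighted mean lies below the graph. *)
Lemma exp_convex (t u v : R) :
  0 <= t <= 1 -> exp ((1 - t) * u + t * v) <= (1 - t) * exp u + t * exp v.
Proof.
intros Ht.
set (w := (1 - t) * u + t * v).
assert (tangent : forall z, exp w * (1 + (z - w)) <= exp z).
{ intros z.
  replace (exp z) with (exp w * exp (z - w)) by (rewrite <- exp_plus; f_equal; ring).
  apply Rmult_le_compat_l; [left; apply exp_pos | apply exp_ineq1_le]. }
pose proof (Rmult_le_compat_l (1 - t) _ _ ltac:(lra) (tangent u)) as Hu.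
pose proof (Rmult_le_compat_l t _ _ ltac:(lra) (tangent v)) as Hv.
assert ((1 - t) * (exp w * (1 + (u - w))) + t * (exp w * (1 + (v - w))) = exp w)
  by (unfold w; ring).
lra.
Qed.

Lemma ln_le (x y : R) : 0 < x -> x <= y -> ln x <= ln y.
Proof.
intros Hx [Hxy | ->]; [left; now apply ln_increasing | right; reflexivity].
Qed.

(** The exponential is convex and increasing, and [r * ln x] is convex because
    [ln] is concave and [r <= 0]. *)
Lemma Rpower_convex_nonpos (r t x y : R) :
  r <= 0 -> 0 <= t <= 1 -> 0 < x -> 0 < y ->
  Rpower ((1 - t) * x + t * y) r <= (1 - t) * Rpower x r + t * Rpower y r.
Proof.
intros Hr Ht Hx Hy.
assert (ln_concave : (1 - t) * ln x + t * ln y <= ln ((1 - t) * x + t * y)).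
{ rewrite <- (ln_exp ((1 - t) * ln x + t * ln y)).
  apply ln_le; [apply exp_pos |].
  pose proof (exp_convex t (ln x) (ln y) Ht) as H.
  now rewrite !exp_ln in H. }
unfold Rpower.
apply Rle_trans with (exp ((1 - t) * (r * ln x) + t * (r * ln y)));
  [| now apply exp_convex].
pose proof (Rmult_le_compat_neg_l r _ _ Hr ln_concave) as H.
destruct (Req_dec (r * ln ((1 - t) * x + t * y)) ((1 - t) * (r * ln x) + t * (r * ln y)))
  as [-> | Hne]; [right; reflexivity |].
left; apply exp_increasing; lra.
Qed.

Lemma young (p q u v : R) :
  0 < p -> 0 < q -> 1 / p + 1 / q = 1 -> 0 < u -> 0 < v ->
  Rpower u (1 / p) * Rpower v (1 / q) <= 1 / p * u + 1 / q * v.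
Proof.
intros Hp Hq Hpq Hu Hv.
assert (0 < 1 / p) by (apply Rdiv_lt_0_compat; lra).
assert (0 < 1 / q) by (apply Rdiv_lt_0_compat; lra).
pose proof (exp_convex (1 / q) (ln u) (ln v) ltac:(lra)) as H1.
replace (1 - 1 / q) with (1 / p) in H1 by lra.
rewrite exp_plus, !exp_ln in H1 by assumption.
exact H1.
Qed.

Lemma Rpower_pos (x r : R) : 0 < Rpower x r.
Proof. apply exp_pos. Qed.

Lemma Rpower_Rpower_inv (x p : R) :
  0 < x -> p <> 0 -> Rpower (Rpower x p) (1 / p) = x.
Proof.
intros Hx Hp. rewrite Rpower_mult.
replace (p * (1 / p)) with 1 by (field; assumption).
now apply Rpower_1.
Qed.

Lemma Rpower_div (x y r : R) :
  0 < x -> 0 < y -> Rpower (x / y) r = Rpower x r / Rpower y r.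
Proof.
intros Hx Hy. unfold Rdiv.
rewrite <- Rpower_mult_distr; [| assumption | now apply Rinv_0_lt_compat].
f_equal. unfold Rpower. rewrite ln_Rinv by assumption.
rewrite <- exp_Ropp. f_equal. ring.
Qed.

(** Young's inequality applied to each of the two products after both vectors
    have been scaled to norm one. *)
Lemma holder_two (p q u v x y : R) :
  0 < p -> 0 < q -> 1 / p + 1 / q = 1 ->
  0 < u -> 0 < v -> 0 < x -> 0 < y ->
  u * x + v * y <=
    Rpower (Rpower u p + Rpower v p) (1 / p) *
    Rpower (Rpower x q + Rpower y q) (1 / q).
Proof.
intros Hp Hq Hpq Hu Hv Hx Hy.
pose proof (Rpower_pos u p) as Up; pose proof (Rpower_pos v p) as Vp.
pose proof (Rpower_pos x q) as Xq; pose proof (Rpower_pos y q) as Yq.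
set (S := Rpower u p + Rpower v p).
set (T := Rpower x q + Rpower y q).
assert (HS : 0 < S) by (unfold S; lra).
assert (HT : 0 < T) by (unfold T; lra).
pose proof (Rpower_pos S (1 / p)) as Sp; pose proof (Rpower_pos T (1 / q)) as Tq.
assert (scaled : forall w z, 0 < w -> 0 < z ->
  w / Rpower S (1 / p) * (z / Rpower T (1 / q)) <=
    1 / p * (Rpower w p / S) + 1 / q * (Rpower z q / T)).
{ intros w z Hw Hz.
  pose proof (young p q (Rpower w p / S) (Rpower z q / T) Hp Hq Hpq
    (Rdiv_lt_0_compat _ _ (Rpower_pos w p) HS)
    (Rdiv_lt_0_compat _ _ (Rpower_pos z q) HT)) as H.
  rewrite !Rpower_div, !Rpower_Rpower_inv in H
    by (assumption || apply Rpower_pos || lra).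
  exact H. }
pose proof (scaled u x Hu Hx) as H1.
pose proof (scaled v y Hv Hy) as H2.
assert (total : 1 / p * (Rpower u p / S) + 1 / q * (Rpower x q / T)
  + (1 / p * (Rpower v p / S) + 1 / q * (Rpower y q / T)) = 1).
{ transitivity (1 / p + 1 / q); [| exact Hpq]. unfold S, T. field.
  fold S T. repeat split; lra. }
assert (H : (u * x + v * y) / (Rpower S (1 / p) * Rpower T (1 / q)) <= 1).
{ replace ((u * x + v * y) / (Rpower S (1 / p) * Rpower T (1 / q)))
    with (u / Rpower S (1 / p) * (x / Rpower T (1 / q))
          + v / Rpower S (1 / p) * (y / Rpower T (1 / q)))
    by (field; split; lra).
  lra. }
apply Rmult_le_compat_r with (r := Rpower S (1 / p) * Rpower T (1 / q)) in H;
  [| left; now apply Rmult_lt_0_compat].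
rewrite Rmult_1_l in H.
replace (u * x + v * y)
  with ((u * x + v * y) / (Rpower S (1 / p) * Rpower T (1 / q))
        * (Rpower S (1 / p) * Rpower T (1 / q))) by (field; split; lra).
exact H.
Qed.

(** * The numerical inequality between the weights *)

Lemma ln2_ge : 2 / 3 <= ln 2.
Proof.
(* [14/15 <= exp (-1/15)], and [(15/14)^10 < 2]. *)
assert (H : exp (1 / 15) <= 15 / 14).
{ pose proof (exp_ineq1_le (- (1 / 15))) as H. rewrite exp_Ropp in H.
  pose proof (exp_pos (1 / 15)) as Hpos.
  apply Rmult_le_compat_l with (r := exp (1 / 15)) in H; [| lra].
  rewrite Rinv_r in H by lra. lra. }
rewrite <- (ln_exp (2 / 3)). apply ln_le; [apply exp_pos |].
replace (2 / 3) with (INR 10 * (1 / 15)) by (simpl; lra).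
rewrite <- (ln_exp (1 / 15)).
change (Rpower (exp (1 / 15)) (INR 10) <= 2).
rewrite Rpower_pow by apply exp_pos.
apply Rle_trans with ((15 / 14) ^ 10); [| lra].
apply pow_incr. split; [left; apply exp_pos | exact H].
Qed.

Lemma Rpower_bernoulli (k x : R) : 2 <= k -> 0 <= x -> 1 + 2 / 3 * x <= Rpower k x.
Proof.
intros Hk Hx. unfold Rpower.
pose proof (exp_ineq1_le (x * ln k)) as H.
pose proof (ln_le 2 k ltac:(lra) Hk) as Hln. pose proof ln2_ge.
pose proof (Rmult_le_compat_l x (2 / 3) (ln k) Hx ltac:(lra)). lra.
Qed.

(** After multiplication by [2^p], the two weights contribute at most [3/2] and
    [1/2] times [1/(2p+1)], which is sharp at [p = 1]. *)
Lemma weights_bound (p : R) : 1 <= p ->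
  Rpower (1 / 4) p + Rpower (1 / 12) p <= Rpower 2 (1 - p) / (2 * p + 1).
Proof.
intros Hp.
assert (quotient : forall k, 2 <= k ->
  Rpower (1 / k) p <= 3 / k * / (2 * p + 1)).
{ intros k Hk.
  pose proof (Rpower_bernoulli k (p - 1) Hk ltac:(lra)) as H.
  rewrite Rpower_div by lra.
  replace (Rpower 1 p) with 1 by (unfold Rpower; rewrite ln_1, Rmult_0_r, exp_0; reflexivity).
  replace (Rpower k p) with (k * Rpower k (p - 1)).
  2:{ rewrite <- (Rpower_1 k) at 1 by lra. rewrite <- Rpower_plus. f_equal; ring. }
  replace (3 / k * / (2 * p + 1)) with (1 / (k * ((2 * p + 1) / 3))) by (field; lra).
  unfold Rdiv at 1 3. apply Rmult_le_compat_l; [lra |].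
  apply Rinv_le_contravar; [apply Rmult_lt_0_compat; lra |].
  apply Rmult_le_compat_l; lra. }
pose proof (quotient 2 ltac:(lra)) as H2.
pose proof (quotient 6 ltac:(lra)) as H6.
assert (halve : forall k, 0 < k -> Rpower (1 / (2 * k)) p = Rpower (1 / 2) p * Rpower (1 / k) p).
{ intros k Hk. rewrite Rpower_mult_distr by (apply Rdiv_lt_0_compat; lra).
  f_equal. field. lra. }
replace (1 / 4) with (1 / (2 * 2)) by lra.
replace (1 / 12) with (1 / (2 * 6)) by lra.
rewrite !halve by lra.
replace (Rpower 2 (1 - p)) with (2 * Rpower (1 / 2) p).
2:{ unfold Rminus. rewrite Rpower_plus, Rpower_1, Rpower_Ropp, Rpower_div by lra.
  replace (Rpower 1 p) with 1 by (unfold Rpower; rewrite ln_1, Rmult_0_r, exp_0; reflexivity).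
  field. apply Rgt_not_eq, Rpower_pos. }
replace (2 * Rpower (1 / 2) p / (2 * p + 1))
  with (Rpower (1 / 2) p * (2 * / (2 * p + 1))) by (field; lra).
rewrite <- Rmult_plus_distr_l.
apply Rmult_le_compat_l; [left; apply Rpower_pos | lra].
Qed.

(** Hoelder with weights [1/4] and [1/12]: here [(2^(1-p))^(1/p) = 2^(-1/q)],
    and [c <= 2] only weakens the constant. *)
Lemma weighted_sum_bound (p q c x y : R) :
  1 < p -> 1 < q -> 1 / p + 1 / q = 1 -> 0 < c <= 2 -> 0 < x -> 0 < y ->
  x / 4 + y / 12 <=
    Rpower (Rpower x q + Rpower y q) (1 / q) /
    (Rpower c (1 / q) * Rpower (2 * p + 1) (1 / p)).
Proof.
intros Hp Hq Hpq Hc Hx Hy.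
pose proof (holder_two p q (1 / 4) (1 / 12) x y) as H.
specialize (H ltac:(lra) ltac:(lra) Hpq ltac:(lra) ltac:(lra) Hx Hy).
assert (Hp' : 0 < 1 / p) by (apply Rdiv_lt_0_compat; lra).
assert (Hq' : 0 < 1 / q) by (apply Rdiv_lt_0_compat; lra).
assert (K : Rpower (Rpower (1 / 4) p + Rpower (1 / 12) p) (1 / p)
            <= / (Rpower c (1 / q) * Rpower (2 * p + 1) (1 / p))).
{ apply Rle_trans with (Rpower (Rpower 2 (1 - p) / (2 * p + 1)) (1 / p)).
  - apply Rle_Rpower_l; [lra |]. split.
    + apply Rplus_lt_0_compat; apply Rpower_pos.
    + apply weights_bound; lra.
  - rewrite Rpower_div by (apply Rpower_pos || lra).
    rewrite Rpower_mult.
    replace ((1 - p) * (1 / p)) with (- (1 / q)).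
    2:{ replace (1 / q) with (1 - 1 / p) by lra. field; lra. }
    rewrite Rpower_Ropp, Rinv_mult.
    apply Rmult_le_compat_r; [left; apply Rinv_0_lt_compat, Rpower_pos |].
    apply Rinv_le_contravar; [apply Rpower_pos |].
    apply Rle_Rpower_l; lra. }
apply Rmult_le_compat_r with (r := Rpower (Rpower x q + Rpower y q) (1 / q)) in K;
  [| left; apply Rpower_pos].
unfold Rdiv at 3. lra.
Qed.

(** * Taylor remainders of the primitive of a power *)

Lemma nonneg_of_derivative (f f' : R -> R) :
  (forall t, 0 <= t <= 1 -> is_derive f t (f' t)) -> f 0 = 0 ->
  (forall t, 0 <= t <= 1 -> 0 <= f' t) ->
  forall t, 0 <= t <= 1 -> 0 <= f t.
Proof.
intros Hd H0 Hpos t [Ht0 Ht1].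
destruct Ht0 as [Ht0 | <-]; [| lra].
destruct (MVT_cor2 f f' 0 t Ht0) as [c [Hc Hct]].
{ intros c Hc. apply is_derive_Reals, Hd. lra. }
pose proof (Hpos c ltac:(lra)) as Hf.
pose proof (Rmult_le_pos _ (t - 0) Hf ltac:(lra)). lra.
Qed.

Lemma nonneg_of_third_derivative (f f1 f2 f3 : R -> R) :
  (forall t, 0 <= t <= 1 -> is_derive f t (f1 t)) ->
  (forall t, 0 <= t <= 1 -> is_derive f1 t (f2 t)) ->
  (forall t, 0 <= t <= 1 -> is_derive f2 t (f3 t)) ->
  f 0 = 0 -> f1 0 = 0 -> f2 0 = 0 ->
  (forall t, 0 <= t <= 1 -> 0 <= f3 t) -> 0 <= f 1.
Proof.
intros D0 D1 D2 Z0 Z1 Z2 Hpos.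
apply (nonneg_of_derivative f f1); [assumption.. | | lra].
apply (nonneg_of_derivative f1 f2); [assumption.. |].
now apply (nonneg_of_derivative f2 f3).
Qed.

Lemma segment_pos (m e t : R) : 0 < m -> 0 < m + e -> 0 <= t <= 1 -> 0 < m + t * e.
Proof.
intros Hm Hme Ht. destruct (Rle_lt_dec 0 e) as [He | He].
- pose proof (Rmult_le_pos t e). lra.
- pose proof (Rmult_le_compat_neg_l e t 1). lra.
Qed.

Lemma is_derive_Rpower (r x : R) : 0 < x ->
  is_derive (fun x : R => Rpower x r) x (r * Rpower x (r - 1)).
Proof. intros Hx. now apply is_derive_Reals, derivable_pt_lim_power. Qed.

(** The division by the step [e] makes the sign of the third-order remainder
    independent of the side of [m] on which [m + e] lies. *)
Definition taylor_remainder (F F1 F2 : R -> R) (m e : R) : R :=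
  (F (m + e) - F m - e * F1 m - e ^ 2 / 2 * F2 m) / e.

(** The function compared with zero is [k] times the remainder along the
    segment plus the quartic whose third derivative is [e^2 * (u + t * v)]. *)
Lemma taylor_remainder_compare (F F1 F2 F3 : R -> R) (m e k u v : R) :
  e <> 0 ->
  (forall t, 0 <= t <= 1 -> is_derive F (m + t * e) (F1 (m + t * e))) ->
  (forall t, 0 <= t <= 1 -> is_derive F1 (m + t * e) (F2 (m + t * e))) ->
  (forall t, 0 <= t <= 1 -> is_derive F2 (m + t * e) (F3 (m + t * e))) ->
  (forall t, 0 <= t <= 1 -> 0 <= k * F3 (m + t * e) + (u + t * v)) ->
  0 <= k * taylor_remainder F F1 F2 m e + e ^ 2 * (u / 6 + v / 24).
Proof.
intros He D0 D1 D2 Hpos.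
pose proof (nonneg_of_third_derivative
  (fun t => k / e * (F (m + t * e) - F m - t * e * F1 m - t ^ 2 * e ^ 2 / 2 * F2 m)
     + e ^ 2 * (t ^ 3 * u / 6 + t ^ 4 * v / 24))
  (fun t => k * (F1 (m + t * e) - F1 m - t * e * F2 m)
     + e ^ 2 * (t ^ 2 * u / 2 + t ^ 3 * v / 6))
  (fun t => k * e * (F2 (m + t * e) - F2 m) + e ^ 2 * (t * u + t ^ 2 * v / 2))
  (fun t => e ^ 2 * (k * F3 (m + t * e) + (u + t * v)))) as H.
cbv beta in H.
replace (k * taylor_remainder F F1 F2 m e + e ^ 2 * (u / 6 + v / 24)) with
 (k / e * (F (m + 1 * e) - F m - 1 * e * F1 m - 1 ^ 2 * e ^ 2 / 2 * F2 m)
     + e ^ 2 * (1 ^ 3 * u / 6 + 1 ^ 4 * v / 24)).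
2:{ unfold taylor_remainder. rewrite !Rmult_1_l. field. assumption. }
apply H; clear H.
- intros t Ht. pose proof (D0 t Ht) as D. auto_derive.
  + eexists; exact D.
  + rewrite (is_derive_unique (fun x : R => F x) _ _ D). field. assumption.
- intros t Ht. pose proof (D1 t Ht) as D. auto_derive.
  + eexists; exact D.
  + rewrite (is_derive_unique (fun x : R => F1 x) _ _ D). field.
- intros t Ht. pose proof (D2 t Ht) as D. auto_derive.
  + eexists; exact D.
  + rewrite (is_derive_unique (fun x : R => F2 x) _ _ D). field.
- rewrite Rmult_0_l, Rplus_0_r. field. assumption.
- rewrite Rmult_0_l, Rplus_0_r. field.
- rewrite Rmult_0_l, Rplus_0_r. field.
- intros t Ht. apply Rmult_le_pos; [apply pow2_ge_0 | now apply Hpos].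
Qed.

(** Here the third derivative of the primitive is [- s(1-s) x^(s-2)]: it is
    nonpositive and, by convexity of [x^(s-2)], at least its linear
    interpolation between [m] and [m + e]. *)
Lemma power_remainder_bounds (s m e : R) :
  0 < s < 1 -> 0 < m -> 0 < m + e -> e <> 0 ->
  - (e ^ 2 * (s * (1 - s)) * (Rpower m (s - 2) / 8 + Rpower (m + e) (s - 2) / 24))
  <= taylor_remainder (fun x => Rpower x (s + 1) / (s + 1))
       (fun x => Rpower x s) (fun x => s * Rpower x (s - 1)) m e
  <= 0.
Proof.
intros Hs Hm Hme He.
pose proof (fun k u v => taylor_remainder_compare
  (fun x => Rpower x (s + 1) / (s + 1)) (fun x => Rpower x s)
  (fun x => s * Rpower x (s - 1)) (fun x => - (s * (1 - s)) * Rpower x (s - 2))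
  m e k u v He) as H.
cbv beta in H.
assert (Hc : 0 < s * (1 - s)) by (apply Rmult_lt_0_compat; lra).
assert (compare : forall k u v,
  (forall t, 0 <= t <= 1 ->
    0 <= k * (- (s * (1 - s)) * Rpower (m + t * e) (s - 2)) + (u + t * v)) ->
  0 <= k * taylor_remainder (fun x => Rpower x (s + 1) / (s + 1))
       (fun x => Rpower x s) (fun x => s * Rpower x (s - 1)) m e
       + e ^ 2 * (u / 6 + v / 24)).
{ intros k u v. apply H; clear H; intros t Ht;
    pose proof (segment_pos m e t Hm Hme Ht) as Hx.
  - pose proof (is_derive_Rpower (s + 1) _ Hx) as D.
    auto_derive; [eexists; exact D |].
    rewrite (is_derive_unique _ _ _ D).
    replace (s + 1 - 1) with s by ring. field. lra.
  - now apply is_derive_Rpower.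
  - pose proof (is_derive_Rpower (s - 1) _ Hx) as D.
    auto_derive; [eexists; exact D |].
    rewrite (is_derive_unique _ _ _ D).
    replace (s - 1 - 1) with (s - 2) by ring. ring. }
clear H. set (X := Rpower m (s - 2)). set (Y := Rpower (m + e) (s - 2)).
split.
- pose proof (compare 1 (s * (1 - s) * X) (s * (1 - s) * (Y - X))) as H.
  enough (0 <= 1 * taylor_remainder (fun x => Rpower x (s + 1) / (s + 1))
       (fun x => Rpower x s) (fun x => s * Rpower x (s - 1)) m e
       + e ^ 2 * (s * (1 - s) * X / 6 + s * (1 - s) * (Y - X) / 24)) by lra.
  apply H. intros t Ht.
  pose proof (Rpower_convex_nonpos (s - 2) t m (m + e) ltac:(lra) Ht Hm Hme) as C.
  replace ((1 - t) * m + t * (m + e)) with (m + t * e) in C by ring.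
  fold X Y in C.
  apply Rmult_le_compat_l with (r := s * (1 - s)) in C; lra.
- pose proof (compare (-1) 0 0) as H.
  enough (0 <= -1 * taylor_remainder (fun x => Rpower x (s + 1) / (s + 1))
       (fun x => Rpower x s) (fun x => s * Rpower x (s - 1)) m e
       + e ^ 2 * (0 / 6 + 0 / 24)) by lra.
  apply H. intros t Ht.
  pose proof (Rmult_lt_0_compat _ _ Hc (Rpower_pos (m + t * e) (s - 2))). lra.
Qed.

(** * The gap between the two means *)

Lemma gen_log_mean_pow (s a b : R) : 0 < s -> 0 < a < b ->
  Rpower (gen_log_mean s a b) s =
    (Rpower b (s + 1) - Rpower a (s + 1)) / ((b - a) * (s + 1)).
Proof.
intros Hs Hab. unfold gen_log_mean. rewrite Rpower_mult.
replace (1 / s * s) with 1 by (field; lra).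
apply Rpower_1, Rdiv_lt_0_compat.
- pose proof (Rlt_Rpower_l a b (s + 1) ltac:(lra) Hab). lra.
- apply Rmult_lt_0_compat; lra.
Qed.

(** The gap is half the sum of the remainders at [m] with steps [(b-a)/2] and
    [-(b-a)/2], the second-order terms cancelling. *)
Lemma mean_gap_bound (s a b : R) : 0 < s < 1 -> 0 < a < b ->
  Rabs (Rpower (gen_log_mean s a b) s - Rpower (arith_mean a b) s) <=
    (b - a) ^ 2 * s * (1 - s) / 16 *
    ((Rpower (arith_mean a b) (s - 2) / 4 + Rpower a (s - 2) / 12)
     + (Rpower (arith_mean a b) (s - 2) / 4 + Rpower b (s - 2) / 12)).
Proof.
intros Hs Hab. rewrite gen_log_mean_pow by lra.
set (m := arith_mean a b).
assert (Hm : m = (a + b) / 2) by reflexivity.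
pose proof (power_remainder_bounds s m ((b - a) / 2) Hs
  ltac:(lra) ltac:(lra) ltac:(lra)) as Hb.
pose proof (power_remainder_bounds s m (- ((b - a) / 2)) Hs
  ltac:(lra) ltac:(lra) ltac:(lra)) as Ha.
unfold taylor_remainder in Ha, Hb.
replace (m + (b - a) / 2) with b in Hb by lra.
replace (m + - ((b - a) / 2)) with a in Ha by lra.
assert (average :
  (Rpower b (s + 1) - Rpower a (s + 1)) / ((b - a) * (s + 1)) - Rpower m s =
  ((Rpower b (s + 1) / (s + 1) - Rpower m (s + 1) / (s + 1)
     - (b - a) / 2 * Rpower m s
     - ((b - a) / 2) ^ 2 / 2 * (s * Rpower m (s - 1))) / ((b - a) / 2)
   + (Rpower a (s + 1) / (s + 1) - Rpower m (s + 1) / (s + 1)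
     - - ((b - a) / 2) * Rpower m s
     - (- ((b - a) / 2)) ^ 2 / 2 * (s * Rpower m (s - 1))) / (- ((b - a) / 2))) / 2).
{ field. lra. }
rewrite average, Rabs_left1 by lra.
lra.
Qed.

Lemma conjugate_gt_1 (p q : R) : 1 < q -> 1 / p + 1 / q = 1 -> 1 < p.
Proof.
intros Hq Hpq.
assert (Hq' : 0 < 1 / q < 1).
{ split; [apply Rdiv_lt_0_compat; lra |].
  apply Rmult_lt_reg_r with q; [lra |].
  replace (1 / q * q) with 1 by (field; lra). lra. }
(* Stated for [/ p] so that [p = 0], where [/ p = 0], needs no separate case. *)
assert (Hp : 0 < / p < 1) by (unfold Rdiv in *; lra).
rewrite <- (Rinv_inv p), <- Rinv_1.
apply Rinv_lt_contravar; lra.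
Qed.

Theorem proposition2 (a b s : R) (ha : 0 < a) (hab : a < b)
  (hs0 : 0 < s) (hs1 : s < 1) :
  forall q : R, 1 < q ->
  forall p : R, 1 / p + 1 / q = 1 ->
  Rabs (Rpower (gen_log_mean s a b) s - Rpower (arith_mean a b) s) <=
    ((b - a) ^ 2 * s * (1 - s)) /
      (16 * Rpower (s + 1) (1 / q) * Rpower (2 * p + 1) (1 / p)) *
    (Rpower (Rpower a ((s - 2) * q) + Rpower (arith_mean a b) ((s - 2) * q))
       (1 / q) +
     Rpower (Rpower (arith_mean a b) ((s - 2) * q) + Rpower b ((s - 2) * q))
       (1 / q)).
Proof.
intros q Hq p Hpq.
pose proof (conjugate_gt_1 p q Hq Hpq) as Hp.
eapply Rle_trans; [apply mean_gap_bound; lra |].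
set (m := arith_mean a b).
pose proof (fun x y => weighted_sum_bound p q (s + 1) x y Hp Hq Hpq ltac:(lra)) as W.
pose proof (W _ _ (Rpower_pos m (s - 2)) (Rpower_pos a (s - 2))) as Wa.
pose proof (W _ _ (Rpower_pos m (s - 2)) (Rpower_pos b (s - 2))) as Wb.
rewrite !Rpower_mult in Wa, Wb.
rewrite (Rplus_comm (Rpower m ((s - 2) * q))) in Wa.
assert (Hc : 0 <= (b - a) ^ 2 * s * (1 - s) / 16).
{ repeat apply Rmult_le_pos; lra. }
pose proof (Rmult_le_compat_l _ _ _ Hc (Rplus_le_compat _ _ _ _ Wa Wb)) as K.
eapply Rle_trans; [exact K |]. right.
field. split; apply Rgt_not_eq, Rpower_pos.
Qed.
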